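(* Let $n\ge3$, $1\le k\le n$, let $A=\mathrm{diag}(a_1,\dots,a_n)\in\mathcal{A}_k$, and let $0<\alpha<\beta<\infty$. If there exists a function $\omega\in C^2(\alpha,\beta)$ with $\omega''\not\equiv0$ in $(\alpha,\beta)$ such that $x\mapsto\omega\left(\frac12\sum_{i=1}^n a_ix_i^2\right)$ is a solution of $$\sigma_k(\lambda(D^2u))=1\quad\text{in}\quad\left\{x\in\mathbb{R}^n : \alpha<\tfrac12\sum_{i=1}^n a_ix_i^2<\beta\right\},$$ then $$k=n\quad\text{or}\quad a_1=a_2=\cdots=a_n=c^*,\qquad\text{where } c^*=(C_n^k)^{-1/k},\ \ C_n^k=\frac{n!}{(n-k)!\,k!}.$$ Conversely, if $k=n$ or $a_1=\cdots=a_n=c^*$, then such an $\omega$ exists.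
   Context: For $\lambda\in\mathbb{R}^n$, $\sigma_k(\lambda)=\sum_{1\le i_1<\cdots<i_k\le n}\lambda_{i_1}\cdots\lambda_{i_k}$ is the $k$-th elementary symmetric function; $\lambda(M)$ denotes the eigenvalues of a real symmetric matrix $M$. $\mathcal{A}_k$ is the set of real $n\times n$ symmetric positive definite matrices $A$ with $\sigma_k(\lambda(A))=1$; thus here $a_i>0$ for all $i$ and $\sigma_k(a_1,\dots,a_n)=1$. The $C^2$ function $x\mapsto\omega(\frac12\sum_i a_ix_i^2)$ is a solution if it satisfies the equation pointwise; $\omega''$ is the second derivative of the one-variable function $\omega$. *)

(* Defs.v *)
From HB Require Import structures.
From mathcomp Require Import all_boot all_order all_algebra.
From mathcomp Require Import all_classical all_reals all_analysis.

Set Implicit Arguments.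
Unset Strict Implicit.
Unset Printing Implicit Defensive.

Import Order.TTheory GRing.Theory Num.Theory.
Import numFieldNormedType.Exports.

Local Open Scope classical_set_scope.
Local Open Scope ring_scope.

(* Strictly increasing index families i_1 < ... < i_k are encoded as the
   k-element subsets of 'I_n. *)
Definition sigma (R : realType) (n k : nat) (lam : 'rV[R]_n) : R :=
  \sum_(I : {set 'I_n} | #|I| == k) \prod_(i in I) lam 0 i.

(* Eigenvalues listed with algebraic multiplicity, in an unspecified order.
   The default value 0 is only returned when the characteristic polynomial
   does not split over R, which cannot happen for a symmetric matrix. *)
Definition eigenvalues (R : realType) (n : nat) (M : 'M[R]_n) : 'rV[R]_n :=
  xget 0 [set lam : 'rV[R]_n |
            char_poly M = \prod_(i < n) ('X - (lam 0 i)%:P)].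

Definition positive_definite (R : realType) (n : nat) (M : 'M[R]_n) : Prop :=
  forall v : 'rV[R]_n, v != 0 -> 0 < (v *m M *m v^T) 0 0.

Definition calA (R : realType) (n k : nat) : set 'M[R]_n :=
  [set A | [/\ A \is symmetricmx, positive_definite A &
               sigma k (eigenvalues A) = 1]].

Definition partial (R : realType) (n : nat) (i : 'I_n) (u : 'rV[R]_n -> R) :
    'rV[R]_n -> R :=
  fun x => 'D_(delta_mx 0 i) u x.

Definition hessian (R : realType) (n : nat) (u : 'rV[R]_n -> R)
    (x : 'rV[R]_n) : 'M[R]_n :=
  \matrix_(i < n, j < n) partial i (partial j u) x.

Definition half_quad (R : realType) (n : nat) (a x : 'rV[R]_n) : R :=
  2^-1 * \sum_(i < n) a 0 i * x 0 i ^+ 2.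

Definition shell (R : realType) (n : nat) (a : 'rV[R]_n) (alpha beta : R) :
    set 'rV[R]_n :=
  [set x | alpha < half_quad a x < beta].

Definition solves_hessian_eq (R : realType) (n k : nat)
    (D : set 'rV[R]_n) (u : 'rV[R]_n -> R) : Prop :=
  forall x, D x -> sigma k (eigenvalues (hessian u x)) = 1.

(* w is a total function, but only its values on ]alpha, beta[ matter: the
   interval is open and the conditions are local. *)
Definition C2_on (R : realType) (alpha beta : R) (w : R -> R) : Prop :=
  forall t, alpha < t < beta ->
    [/\ derivable w t 1, derivable w^`()%classic t 1 &
        {for t, continuous w^`(2)%classic}].

Definition cstar (R : realType) (n k : nat) : R :=
  'C(n, k)%:R `^ (- k%:R^-1).

(* Main.v *)
Require Import Defs.
From mathcomp Require Import all_boot all_order all_algebra.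
From mathcomp Require Import all_classical all_reals all_analysis.
From mathcomp Require Import complex spectral ring lra.

(** With [s = half_quad a x] and [y_i = a_i x_i], the Hessian of [w (half_quad a x)]
is [w'(s) diag(a) + w''(s) y^T y].

Necessity: on the axis [x = r e_i] this matrix is diagonal, so the equation reads
[w'^k + 2 s w'' w'^(k-1) (a_i e_(k-1)(a without a_i)) = 1].  Where [w''] does not
vanish, [a_i e_(k-1)(a without a_i)] is therefore independent of [i]; the
difference of two such numbers is [(a_i - a_j) e_(k-1)(a without a_i, a_j)], and
for [k < n] the last factor is positive.

Sufficiency: in both cases the equation reduces, by the rank-one determinant
formula, to [w'^k + (k/n) 2 s w'^(k-1) w'' = 1], which is linear in [w'^k] and
solved by [w'^k = 1 + s^(-n/2)]. *)

Set Implicit Arguments.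
Unset Strict Implicit.

Import Order.TTheory GRing.Theory Num.Theory.
Import numFieldNormedType.Exports.

Local Open Scope classical_set_scope.
Local Open Scope ring_scope.

(** * Determinant of a rank-one update *)

(* Inverse-free, so that over polynomials [A = 'X - c] is covered by [B = 1]. *)
Lemma det_rank1_update (R : comNzRingType) (n : nat) (A B : 'M[R]_n)
    (u : 'cV[R]_n) (v : 'rV[R]_n) (d : R) :
  A *m B = d%:M -> d * \det (A + u *m v) = \det A * (d + (v *m B *m u) 0 0).
Proof.
(* The determinant of the bordered matrix [M] is computed twice: clearing its lower-left block
   leaves [A + u *m v], while clearing the upper-right block with [AB] leaves [A] and the scalar
   [d + v *m B *m u]. *)
move=> AB; set M := block_mx A u (- v) (1%:M : 'M[R]_1).
have E1 : M = block_mx (A + u *m v) u 0 1%:M *m block_mx 1%:M 0 (- v) 1%:M.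
  by rewrite mulmx_block !mulmx1 !mul0mx !mul1mx !mulmxN addrK mulmx0 !add0r.
have E2 : M *m block_mx 1%:M (- (B *m u)) 0 d%:M =
          block_mx A 0 (- v) (d%:M + v *m B *m u).
  rewrite mulmx_block !mulmx1 !mulmx0 !addr0 !mulmxN !mulNmx opprK mul1mx !mulmxA.
  by rewrite AB mul_mx_scalar mul_scalar_mx addNr addrC.
have := congr1 determinant E2; rewrite det_mulmx E1 det_mulmx.
rewrite !det_lblock !det_ublock !det1 !mulr1 !mul1r
  det_scalar1.
move=> /(etrans (mulrC _ _)) ->.
by rewrite det_mx11 !mxE eqxx mulr1n.
Qed.

(** * Characteristic polynomials and real diagonalisation *)

Lemma char_poly_similar (R : fieldType) (n : nat) (P A B : 'M[R]_n) :
  P \in unitmx -> P *m A = B *m P -> char_poly A = char_poly B.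
Proof.
move=> Pu PAB; rewrite /char_poly.
set Q := map_mx (@polyC R) P.
have QE : Q *m char_poly_mx A = char_poly_mx B *m Q.
  rewrite mulmxBr mulmxBl -!map_mxM PAB; congr (_ - _).
  by rewrite mul_mx_scalar mul_scalar_mx.
have Q0 : \det Q != 0 by rewrite det_map_mx polyC_eq0 -unitfE -unitmxE.
by apply: (mulfI Q0); rewrite -det_mulmx QE det_mulmx mulrC.
Qed.

(** Over [R[i]] the matrix is Hermitian, so the spectral theorem diagonalises it with a real
    diagonal; the factorisation descends to [R] because the embedding of coefficients is
    injective. *)
Lemma char_poly_symmetric_split (R : rcfType) (n : nat) (M : 'M[R]_n) :
  M^T = M ->
  exists lam : 'rV[R]_n, char_poly M = \prod_(i < n) ('X - (lam 0 i)%:P).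
Proof.
move=> Msym; pose f := real_complex R; pose Mc := map_mx f M.
have Mreal : Mc \is a mxOver Num.real.
  apply/mxOverP => i j; rewrite mxE.
  by apply/complex_realP; exists (M i j).
have Mherm : Mc \is hermsymmx.
  apply: realsym_hermsym => //; apply/is_hermitianmxP.
  by rewrite expr0 scale1r map_mx_id // map_trmx Msym.
have /orthomx_spectralP ME := hermitian_normalmx Mherm.
have /mxOverP Dreal := hermitian_spectral_diag_real Mherm.
exists (\row_i complex.Re (spectral_diag Mc 0 i)).
apply: (@map_poly_inj _ _ f); rewrite map_char_poly.
rewrite (@char_poly_similar _ _ (spectralmx Mc) _ (diag_mx (spectral_diag Mc))).
- rewrite char_poly_trig ?diag_mx_is_trig // rmorph_prod.
  apply: eq_bigr => i _; rewrite /= rmorphB /= map_polyX map_polyC /= !mxE.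
  by rewrite eqxx mulr1n /f /= RRe_real.
- exact: spectral_unit.
- by rewrite [X in _ *m X = _]ME !mulmxA mulmxV ?mul1mx ?spectral_unit.
Qed.

(** * Elementary symmetric functions as polynomial coefficients *)

(** Generating polynomial of the elementary symmetric functions; the predicate [P] allows single
    indices to be removed. *)
Definition esympoly (R : comNzRingType) (T : finType) (P : pred T)
    (f : T -> R) : {poly R} :=
  \prod_(i | P i) (1 + f i *: 'X).

(** Expanding the product over subsets, the subset [I] contributes only in degree [#|I|]. *)
Lemma sigmaE (R : realType) (n k : nat) (lam : 'rV[R]_n) :
  sigma k lam = (esympoly predT (lam 0))`_k.
Proof.
rewrite /esympoly.
under eq_bigr do rewrite addrC.
rewrite (@bigA_distr _ _ 1 *%R +%R) coef_sum.
rewrite [RHS](bigID (fun I : {set 'I_n} => #|I| == k)) /=.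
have E (I : {set 'I_n}) :
    \prod_i (if i \in I then lam 0 i *: 'X else 1) =
    (\prod_(i in I) lam 0 i) *: 'X^#|I| :> {poly R}.
  by rewrite -big_mkcond /= scaler_prod prodr_const.
rewrite [X in _ + X]big1 ?addr0 => [|I Ik].
  apply: eq_bigr => I /eqP Ik; rewrite E coefZ coefXn Ik eqxx mulr1 //.
by rewrite E coefZ coefXn eq_sym (negbTE Ik) mulr0.
Qed.

(** Vieta's formula, by the same expansion over subsets: indices in [I] contribute a root, the
    others a factor ['X]. *)
Lemma coef_prod_XsubC_sigma (R : realType) (n k : nat) (lam : 'rV[R]_n) :
  (k <= n)%N ->
  (\prod_(i < n) ('X - (lam 0 i)%:P))`_(n - k) = (-1) ^+ k * sigma k lam.
Proof.
move=> kn.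
under eq_bigr do rewrite addrC -scaleN1r -mul_polyC -polyCM mulN1r.
rewrite (@bigA_distr _ _ 1 *%R +%R) coef_sum.
rewrite (bigID (fun I : {set 'I_n} => #|I| == k)) /=.
have E (I : {set 'I_n}) :
    \prod_i (if i \in I then (- lam 0 i)%:P else 'X) =
    ((-1) ^+ #|I| * \prod_(i in I) lam 0 i) *: 'X^(n - #|I|) :> {poly R}.
  rewrite (bigID (mem I)) /= -mul_polyC.
  under eq_bigr => i iI do rewrite iI.
  under [X in _ * X]eq_bigr => i iI do rewrite (negbTE iI).
  rewrite -rmorph_prod prodrN prodr_const.
  congr (_ * 'X ^+ _).
  apply/eqP; rewrite -(eqn_add2l #|I|) subnKC ?cardC ?card_ord //.
  by rewrite -[leqRHS]card_ord max_card.
rewrite [X in _ + X]big1 ?addr0 => [|I Ik]; last first.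
  (* Both [k] and [#|I|] are at most [n], so equal truncated differences from [n] force them to be
     equal. *)
  rewrite E coefZ coefXn; case: eqP => [Ek|]; last by rewrite mulr0.
  have := max_card (mem I); rewrite card_ord => In.
  by move: Ik; rewrite -(subKn In) -Ek subKn ?eqxx.
rewrite /sigma mulr_sumr; apply: eq_bigr => I /eqP Ik.
by rewrite E coefZ coefXn Ik eqxx mulr1.
Qed.

(** By Vieta, [sigma k] depends only on the characteristic polynomial, so the listing picked by
    [xget] is irrelevant; [lam] shows that the default value is not returned. *)
Lemma sigma_eigenvalues (R : realType) (n k : nat) (M : 'M[R]_n) (lam : 'rV[R]_n) :
  (k <= n)%N -> char_poly M = \prod_(i < n) ('X - (lam 0 i)%:P) ->
  sigma k (eigenvalues M) = sigma k lam.
Proof.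
move=> kn Mlam; apply: (mulrI (unitrX k (unitrN1 R))).
rewrite -!coef_prod_XsubC_sigma // -Mlam; congr (_`__).
by rewrite /eigenvalues; case: xgetP => [x _ /= ->|/(_ lam)].
Qed.

Lemma sigma_eigenvalues_diag (R : realType) (n k : nat) (d : 'rV[R]_n) :
  (k <= n)%N -> sigma k (eigenvalues (diag_mx d)) = sigma k d.
Proof.
move=> kn; apply: sigma_eigenvalues => //.
rewrite char_poly_trig ?diag_mx_is_trig //.
by apply: eq_bigr => i _; rewrite mxE eqxx mulr1n.
Qed.

(** Symmetry provides the splitting; both sides are then the constant coefficient of the
    characteristic polynomial, up to the sign [(-1) ^+ n]. *)
Lemma sigma_eigenvalues_symmetric_det (R : realType) (n : nat) (M : 'M[R]_n) :
  M^T = M -> sigma n (eigenvalues M) = \det M.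
Proof.
move=> /char_poly_symmetric_split[lam Mlam].
rewrite (sigma_eigenvalues _ Mlam) //.
apply: (mulrI (unitrX n (unitrN1 R))).
by rewrite -coef_prod_XsubC_sigma // -Mlam subnn char_poly_det.
Qed.

Lemma esympolyD1 (R : comNzRingType) (T : finType) (P : pred T) (f : T -> R) j :
  P j -> esympoly P f =
         (1 + f j *: 'X) * esympoly (fun i => P i && (i != j)) f.
Proof. by move=> Pj; rewrite /esympoly (bigD1 j). Qed.

Lemma coef_esympolyD1 (R : comNzRingType) (T : finType) (P : pred T)
    (f : T -> R) j k : P j ->
  (esympoly P f)`_k.+1 =
  (esympoly (fun i => P i && (i != j)) f)`_k.+1 +
  f j * (esympoly (fun i => P i && (i != j)) f)`_k.
Proof.
by move=> Pj; rewrite (esympolyD1 f Pj) mulrDl mul1r -scalerAl coefD coefZ coefXM.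
Qed.

Lemma coef_esympoly_scale (R : comNzRingType) (T : finType) (P : pred T)
    (c : R) (f : T -> R) k :
  (esympoly P (fun i => c * f i))`_k = c ^+ k * (esympoly P f)`_k.
Proof.
rewrite /esympoly; elim/big_rec2: _ k => [k|i p q _ IH k].
  by case: k => [|k]; rewrite !coef1 ?mulr0 // expr0 mulr1.
rewrite !mulrDl !mul1r -!scalerAl !coefD !coefZ !coefXM IH.
case: k => [|k] /=; first by rewrite !mulr0 !addr0.
by rewrite IH exprS; ring.
Qed.

Lemma esympoly_const (R : comNzRingType) (T : finType) (P : pred T) (c : R) k :
  (esympoly P (fun=> c))`_k = c ^+ k *+ 'C(#|P|, k).
Proof.
rewrite /esympoly prodr_const.
elim: #|_| k => [|m IH] k.
  by rewrite expr0 coef1; case: k => [|k]; rewrite ?bin0n ?mulr0n ?expr0.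
rewrite exprS mulrDl mul1r -scalerAl coefD coefZ coefXM IH.
case: k => [|k] /=; first by rewrite mulr0 addr0 !bin0.
by rewrite IH binS mulrnDr exprS mulrnAr.
Qed.

Lemma coef_esympoly_gt0 (R : numDomainType) (T : finType) (P : pred T)
    (f : T -> R) k :
  (forall i, 0 < f i) -> (k <= #|P|)%N -> 0 < (esympoly P f)`_k.
Proof.
move=> f0; have -> : esympoly P f = \prod_(i <- enum P) (1 + f i *: 'X).
  by rewrite big_enum.
rewrite cardE; elim: (enum P) k => [|i s IH] k.
  by rewrite leqn0 => /eqP ->; rewrite big_nil coef1.
rewrite /= big_cons mulrDl mul1r -scalerAl coefD coefZ coefXM.
(* In the top degree the summand omitting [i] vanishes, so only nonnegativity is available for it;
   strict positivity comes from the summand containing [f i]. *)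
have ge0 m : 0 <= (\prod_(j <- s) (1 + f j *: 'X))`_m.
  elim: s {IH} m => [|j s IH] m; first by rewrite big_nil coef1.
  rewrite big_cons mulrDl mul1r -scalerAl coefD coefZ coefXM addr_ge0 //.
  by case: m => [|m] /=; rewrite ?mulr0 // mulr_ge0 ?IH // ltW.
case: k => [|k] /= ks; first by rewrite mulr0 addr0 IH.
by apply: ltr_wpDl; rewrite ?mulr_gt0 ?IH.
Qed.

(** * The Hessian of a function of [half_quad] *)

(** Reduces partial derivatives to one-variable calculus at 0. *)
Lemma derive_along_line (R : realType) (n : nat) (f : 'rV[R]_n -> R)
    (x v : 'rV[R]_n) :
  'D_v f x = 'D_1 (fun h : R => f (h *: v + x)) 0.
Proof.
rewrite /derive.
under [in RHS]eq_fun do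
  rewrite /= addr0 scale0r add0r [_ *: (1 : R)]mulr1.
by [].
Qed.

Lemma half_quad_line (R : realType) (n : nat) (a x : 'rV[R]_n) i (h : R) :
  half_quad a (h *: delta_mx 0 i + x) =
  half_quad a x + h * (a 0 i * x 0 i) + 2^-1 * a 0 i * h ^+ 2.
Proof.
rewrite /half_quad (bigD1 i) //= [in RHS](bigD1 i) //= !mxE !eqxx /=.
rewrite (eq_bigr (fun j => a 0 j * x 0 j ^+ 2)) => [|j /negbTE ji]; last first.
  by rewrite !mxE ji andbF mulr0 add0r.
by field.
Qed.

Lemma is_derive_half_quad_line (R : realType) (s b c : R) :
  is_derive (0 : R) 1 (fun h : R => s + h * b + c * h ^+ 2) b.
Proof.
by apply: is_derive_eq; rewrite /GRing.scale /=; ring.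
Qed.

(** The chain rule is applied twice along coordinate lines, on which [half_quad] is a quadratic
    polynomial with slope [a 0 i * x 0 i] at 0. *)
Lemma hessian_radial (R : realType) (n : nat) (a : 'rV[R]_n) (alpha beta : R)
    (w : R -> R) (x : 'rV[R]_n) (s := half_quad a x) :
  C2_on alpha beta w -> shell a alpha beta x ->
  hessian (fun y => w (half_quad a y)) x =
  w^`()%classic s *: diag_mx a +
  w^`(2)%classic s *: \matrix_(i, j) (a 0 i * x 0 i * (a 0 j * x 0 j)).
Proof.
move=> wC2 xs.
have D1 y j : shell a alpha beta y ->
    partial j (fun y => w (half_quad a y)) y =
    w^`()%classic (half_quad a y) * (a 0 j * y 0 j).
  move=> ys; rewrite /partial derive_along_line.
  have [dw _ _] := wC2 _ ys.
  have H : is_derive (0 : R) 1 (w \o (fun h => half_quad a y + h * (a 0 j * y 0 j)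
      + 2^-1 * a 0 j * h ^+ 2)) (w^`()%classic (half_quad a y) * (a 0 j * y 0 j)).
    apply: is_derive1_comp; last exact: is_derive_half_quad_line.
    rewrite mul0r addr0 expr0n mulr0 addr0 derive1E; exact: DeriveDef.
  under eq_fun do rewrite half_quad_line.
  exact: (@derive_val _ _ _ _ _ _ _ H).
apply/matrixP => i j; rewrite !mxE /partial derive_along_line.
have [dw d2w _] := wC2 _ xs.
pose q (h : R) := half_quad a x + h * (a 0 i * x 0 i) + 2^-1 * a 0 i * h ^+ 2.
have dq : is_derive (0 : R) 1 q (a 0 i * x 0 i) by exact: is_derive_half_quad_line.
have q0 : q 0 = s by rewrite /q mul0r addr0 expr0n mulr0 addr0.
(* The formula [D1] holds only inside the shell; differentiating it again requires the line to stay
   there for small [h], which follows from continuity of [q] and openness of the interval. *)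
have qs : \forall h \near (0 : R), shell a alpha beta (h *: delta_mx 0 i + x).
  have cq : {for 0, continuous q}.
    by apply/differentiable_continuous/derivable1_diffP; exact: ex_derive.
  have sI : q 0 \in `]alpha, beta[ by rewrite q0 in_itv.
  have qI : \forall h \near (0 : R), q h \in `]alpha, beta[.
    exact: (cq _ (near_in_itvoo sI)).
  apply: filterS qI => h.
  by rewrite /shell /= half_quad_line in_itv.
have H : is_derive (0 : R) 1
    ((w^`()%classic \o q) * (fun h => a 0 j * (x 0 j + h * (i == j)%:R)))
    (w^`()%classic s * (a 0 j * (i == j)%:R) +
     (a 0 j * x 0 j) * (w^`(2)%classic s * (a 0 i * x 0 i))).
  have H1 : is_derive (0 : R) 1 (w^`()%classic \o q)
      (w^`(2)%classic s * (a 0 i * x 0 i)).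
    apply: is_derive1_comp; rewrite q0 derive1nS derive1n1 derive1E.
    exact: DeriveDef.
  have H2 : is_derive (0 : R) 1 (fun h => a 0 j * (x 0 j + h * (i == j)%:R))
      (a 0 j * (i == j)%:R).
    by apply: is_derive_eq; rewrite /GRing.scale /=; ring.
  by apply: (is_derive_eq (is_deriveM H1 H2)); rewrite /= q0 mul0r addr0 /GRing.scale.
have nE : \forall h \near (0 : R),
    partial j (fun y => w (half_quad a y)) (h *: delta_mx 0 i + x) =
    ((w^`()%classic \o q) * (fun h => a 0 j * (x 0 j + h * (i == j)%:R))) h.
  apply: filterS qs => h hs.
  by rewrite D1 // half_quad_line !mxE eqxx /= [j == i]eq_sym [h * _ + _]addrC.
rewrite [LHS](near_eq_derive _ nE).
rewrite (@derive_val _ _ _ _ _ _ _ H).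
case: eqP => [->|_]; rewrite ?mulr1n ?mulr0n; ring.
Qed.

(** * Necessity: comparison of the equation on the coordinate axes *)

Lemma calA_diag (R : realType) (n k : nat) (a : 'rV[R]_n) :
  (k <= n)%N -> calA k (diag_mx a) -> (forall i, 0 < a 0 i) /\ sigma k a = 1.
Proof.
move=> kn [_ apos asig]; split=> [i|]; last by rewrite -(sigma_eigenvalues_diag a kn).
have /apos : delta_mx 0 i != 0 :> 'rV[R]_n.
  apply/eqP => /matrixP/(_ 0 i); rewrite !mxE !eqxx /= => /eqP.
  by rewrite oner_eq0.
by rewrite trmx_delta -rowE -colE !mxE eqxx mulr1n.
Qed.

(** A nonnegative [c] is recovered from [c ^+ k] by the real power of exponent [k%:R^-1]. *)
Lemma cstar_unique (R : realType) (n k : nat) (c : R) :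
  (0 < k)%N -> 0 <= c -> c ^+ k *+ 'C(n, k) = 1 -> c = cstar R n k.
Proof.
move=> k0 c0 ck.
have C0 : 'C(n, k)%:R != 0 :> R.
  apply/eqP => C0; move: ck; rewrite -mulr_natr C0 mulr0 => /esym/eqP.
  by rewrite oner_eq0.
have -> : c = (c ^+ k) `^ k%:R^-1.
  by rewrite -powR_mulrn // -powRrM divff ?pnatr_eq0 -?lt0n // powRr1.
have -> : c ^+ k = 'C(n, k)%:R `^ (-1).
  rewrite powR_inv1 ?ler0n //; apply: (mulIf C0).
  by rewrite mulVf // mulr_natr.
by rewrite -powRrM mulN1r.
Qed.

(** On the axis of [i] only the [i]-th entry of the vector [a 0 l * x 0 l] survives, so the rank-one
    term occupies one diagonal entry. The radius is chosen so that [half_quad a x = t]. *)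
Lemma hessian_radial_axis (R : realType) (n : nat) (a : 'rV[R]_n) (alpha beta t : R)
    (w : R -> R) i (x := Num.sqrt (2 * t / a 0 i) *: delta_mx 0 i : 'rV[R]_n) :
  C2_on alpha beta w -> 0 < t -> alpha < t < beta -> 0 < a 0 i ->
  shell a alpha beta x /\
  hessian (fun y => w (half_quad a y)) x =
  diag_mx (\row_l (w^`()%classic t * a 0 l +
                   (w^`(2)%classic t * (2 * t) * a 0 i) *+ (l == i))).
Proof.
move=> wC2 t0 tI ai.
have sq : Num.sqrt (2 * t / a 0 i) ^+ 2 = 2 * t / a 0 i.
  by rewrite sqr_sqrtr // divr_ge0 ?mulr_ge0 // ltW.
have xt : half_quad a x = t.
  rewrite -[x]addr0 half_quad_line mxE mulr0 mulr0 addr0 sq /half_quad.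
  rewrite big1 => [|j _]; last by rewrite mxE expr0n mulr0.
  by field; rewrite gt_eqF.
have xs : shell a alpha beta x by rewrite /shell /= xt.
split=> //; rewrite (hessian_radial wC2 xs) xt; apply/matrixP => j l; rewrite !mxE /=.
rewrite ![_ == i]eq_sym.
have [jl|jl] := eqVneq j l; last first.
  rewrite !mulr0n mulr0 add0r; have [ij|] := eqVneq i j.
    by subst j; rewrite (negbTE jl) !mulr0.
  by rewrite !mulr0 mul0r mulr0.
subst l; rewrite !mulr1n; congr (_ + _).
have [ij|ij] := eqVneq i j; last by rewrite !mulr0n !mulr0.
subst j; rewrite mulr1n -[RHS]mulrA; congr (_ * _).
transitivity (a 0 i ^+ 2 * Num.sqrt (2 * t / a 0 i) ^+ 2); first by ring.
by rewrite sq; field; rewrite gt_eqF.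
Qed.

Lemma necessity (R : realType) (n k : nat) (a : 'rV[R]_n)
    (alpha beta t : R) (w : R -> R) :
  (0 < k < n)%N -> (forall i, 0 < a 0 i) -> sigma k a = 1 -> 0 < t ->
  C2_on alpha beta w -> alpha < t < beta -> w^`(2)%classic t != 0 ->
  solves_hessian_eq k (shell a alpha beta) (fun x => w (half_quad a x)) ->
  forall i, a 0 i = cstar R n k.
Proof.
case: k => // k /= kn apos asig t0 wC2 tI w2 sol.
set p := w^`()%classic t; set q := w^`(2)%classic t.
(* The exponent was shifted by the case analysis: [k.+1] is now the order of the equation, so [e i]
   has order one less and omits the index [i]. *)
pose e i := (esympoly (fun l => predT l && (l != i)) (a 0))`_k.
have E i : p ^+ k.+1 + q * (2 * t) * p ^+ k * (a 0 i * e i) = 1.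
  have [xs Hx] := hessian_radial_axis wC2 t0 tI (apos i).
  have := sol _ xs; rewrite Hx sigma_eigenvalues_diag 1?ltnW // sigmaE.
  rewrite (@coef_esympolyD1 _ _ predT _ i) //.
  set d := (\row_l _ : 'rV[R]_n).
  have -> : esympoly (fun l => predT l && (l != i)) (d 0) =
            esympoly (fun l => predT l && (l != i)) (fun l => p * a 0 l).
    by apply: eq_bigr => l /= /negbTE li; rewrite mxE li addr0.
  rewrite !coef_esympoly_scale /d mxE eqxx mulr1n -/p -/q -/(e i) => H.
  rewrite -[RHS]H {H}.
  (* The normalisation of [a] eliminates the coefficient of order [k.+1] without [i], which becomes
     [1 - a 0 i * e i]. *)
  move: asig; rewrite sigmaE (@coef_esympolyD1 _ _ predT _ i) // -/(e i).
  move=> /(canRL (addrK _)) ->; rewrite exprS; ring.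
(* Otherwise both terms of [E] vanish and it reads [0 = 1]; any index will do, and 0 is one since
   [n] is positive. *)
have p0 : p ^+ k != 0.
  apply/eqP => pk; move: (fun i => E i); rewrite exprS pk => F.
  have /eqP := F (Ordinal (ltn_trans (ltn0Sn k) kn)); rewrite mulr0 add0r mulr0 mul0r.
  by rewrite eq_sym oner_eq0.
have ae i j : a 0 i * e i = a 0 j * e j.
  apply: (@mulfI _ (q * (2 * t) * p ^+ k)).
    by rewrite !mulf_neq0 // gt_eqF.
  by apply: (addrI (p ^+ k.+1)); rewrite !E.
have aij i j : a 0 i = a 0 j.
  have [->//|ij] := eqVneq i j.
  (* Expanding [e i] in [a 0 j] and [e j] in [a 0 i] expresses both through the indices other than
     [i] and [j]. *)
  set P := fun l => (predT l && (l != i)) && (l != j).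
  have P' : P =1 (fun l => (predT l && (l != j)) && (l != i)).
    by move=> l; rewrite /P /= andbC.
  have := ae i j; rewrite /e.
  rewrite (@esympolyD1 _ _ (fun l => predT l && (l != i)) _ j) /= 1?eq_sym //.
  rewrite (@esympolyD1 _ _ (fun l => predT l && (l != j)) _ i) //=.
  have -> : esympoly (fun l => (l != j) && (l != i)) (a 0) = esympoly P (a 0).
    by apply: eq_bigl => l; rewrite P'.
  rewrite !mulrDl !mul1r -!scalerAl !coefD !coefZ -/P => F.
  (* Here [k.+1 < n] is decisive: [P] has [n - 2] indices, and [k] does not exceed this number. *)
  have Pk : 0 < (esympoly P (a 0))`_k.
    apply: coef_esympoly_gt0 => //.
    have -> : #|P| = (n - 2)%N.
      have -> : #|P| = #|predC (pred2 i j)|.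
        by apply: eq_card => l; rewrite !inE /= negb_or.
      by rewrite -[in RHS](card_ord n) -(cardC (pred2 i j)) card2 ij addKn.
    by rewrite -(leq_add2r 2) subnK ?addn2 //; apply: leq_trans kn.
  apply: (mulIf (lt0r_neq0 Pk)).
  (* The terms in [y] carry the same factor [a 0 i * a 0 j] on both sides and cancel, leaving
     [a 0 i * x = a 0 j * x]. Keeping ['X] inside [y] avoids a case split at [k = 0]. *)
  move: F; set x := (_)`_k; set y := ('X * _)`_k => F; lra.
move=> i; apply: cstar_unique => //; first exact: ltW.
rewrite -asig sigmaE (_ : a 0 = fun=> a 0 i) ?esympoly_const ?card_ord //.
exact/funext.
Qed.

(** * Sufficiency: an explicit solution of the reduced differential equation *)

(** The integral from [alpha] works: since [alpha] is positive, [g] is continuous on the closed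
    interval and the fundamental theorem of calculus applies. *)
Lemma antiderivative_pos (R : realType) (alpha beta : R) (g : R -> R) :
  0 < alpha -> (forall t, 0 < t -> derivable g t 1) ->
  exists w : R -> R, forall t, alpha < t < beta -> is_derive t 1 w (g t).
Proof.
move=> a0 dg; exists (fun t => \int[lebesgue_measure]_(s in `[alpha, t]) g s).
move=> t /andP[at_ tb].
have ig : lebesgue_measure.-integrable `[alpha, beta] (EFin \o g).
  apply: continuous_compact_integrable; first exact: segment_compact.
  apply: derivable_within_continuous => s; rewrite in_itv /= => /andP[s1 _].
  by apply: dg; exact: lt_le_trans s1.
have cg : {for t, continuous g}.
  apply/differentiable_continuous/derivable1_diffP/dg; exact: lt_trans at_.
have [dF F'] := continuous_FTC1_closed tb ig at_ cg.
by rewrite -F' derive1E; apply: DeriveDef.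
Qed.

(** For [t > 0] this is [t] to the power [-n/2]. *)
Definition powNhalf (R : realType) (n : nat) (t : R) : R :=
  expR (- (n%:R / 2) * ln t).

(** The [k]-th root of [1 + powNhalf n t]. The homogeneous solution [powNhalf n] enters with
    coefficient 1, which keeps the slope from being constant. *)
Definition profile_slope (R : realType) (n k : nat) (t : R) : R :=
  expR (k%:R^-1 * ln (1 + powNhalf n t)).

(** The derivative of [profile_slope] for [t > 0], written as its logarithmic derivative times
    itself. *)
Definition profile_curvature (R : realType) (n k : nat) (t : R) : R :=
  - (n%:R / (2 * k%:R)) * (powNhalf n t / (t * (1 + powNhalf n t))) *
  profile_slope n k t.

Lemma profile_slope_gt0 (R : realType) (n k : nat) (t : R) : 0 < profile_slope n k t.
Proof. exact: expR_gt0. Qed.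

Lemma profile_curvature_neq0 (R : realType) (n k : nat) (t : R) :
  (0 < n)%N -> (0 < k)%N -> 0 < t ->
  profile_curvature n k t != 0.
Proof.
move=> n0 k0 t0; have e0 : 0 < powNhalf n t by exact: expR_gt0.
have ? : n%:R != 0 :> R by rewrite pnatr_eq0 -lt0n.
have ? : k%:R != 0 :> R by rewrite pnatr_eq0 -lt0n.
rewrite !(mulf_eq0, oppr_eq0, invr_eq0) !negb_or !pnatr_eq0 -!lt0n /=.
have ? : 1 + powNhalf n t != 0 by rewrite lt0r_neq0 // addr_gt0.
by do !(apply/andP; split) => //; rewrite ?lt0r_neq0 // profile_slope_gt0.
Qed.

(** With [v] the [k]-th power of the slope, the left side is [v + (2t/n) v'], and
    [v = 1 + powNhalf n t] makes it 1. *)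
Lemma profile_ode (R : realType) (n k : nat) (t : R) :
  (0 < n)%N -> (0 < k)%N -> 0 < t ->
  profile_slope n k t ^+ k +
    k%:R / n%:R * (2 * t) * profile_slope n k t ^+ k.-1 * profile_curvature n k t = 1.
Proof.
move=> n0 k0 t0; have e0 : 0 < powNhalf n t by exact: expR_gt0.
have ? : n%:R != 0 :> R by rewrite pnatr_eq0 -lt0n.
have ? : k%:R != 0 :> R by rewrite pnatr_eq0 -lt0n.
have gk : profile_slope n k t ^+ k = 1 + powNhalf n t.
  by rewrite -expRM_natl mulrA mulfV // mul1r lnK // posrE addr_gt0.
have gk' : profile_slope n k t ^+ k.-1 * profile_slope n k t = 1 + powNhalf n t.
  by rewrite -exprSr prednK.
rewrite /profile_curvature gk.
transitivity (1 + powNhalf n t - powNhalf n t / (1 + powNhalf n t) *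
  (profile_slope n k t ^+ k.-1 * profile_slope n k t)).
  by field; rewrite !lt0r_neq0 ?ltr0n ?addr_gt0.
by rewrite gk'; field; rewrite lt0r_neq0 // addr_gt0.
Qed.

Lemma is_derive_powNhalf (R : realType) (n : nat) (t : R) :
  0 < t -> is_derive t 1 (powNhalf n) (- (n%:R / 2) * (powNhalf n t / t)).
Proof.
move=> t0; have H := is_derive1_ln t0.
by apply: is_derive_eq; rewrite /GRing.scale /= /powNhalf; ring.
Qed.

Lemma is_derive_profile_slope (R : realType) (n k : nat) (t : R) :
  (0 < k)%N -> 0 < t ->
  is_derive t 1 (profile_slope n k) (profile_curvature n k t).
Proof.
move=> k0 t0; have H := is_derive_powNhalf n t0.
have e0 : 0 < powNhalf n t by exact: expR_gt0.
have e1 : 0 < 1 + powNhalf n t by rewrite addr_gt0.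
have H1 : is_derive t 1 (fun t => 1 + powNhalf n t)
    (- (n%:R / 2) * (powNhalf n t / t)).
  by apply: (is_derive_eq (is_deriveD (is_derive_cst (1 : R) t 1) H)); rewrite add0r.
have H2 : is_derive t 1 (@ln R \o (fun t => 1 + powNhalf n t))
    ((1 + powNhalf n t)^-1 * (- (n%:R / 2) * (powNhalf n t / t))).
  by apply: is_derive1_comp; exact: is_derive1_ln.
have ? : k%:R != 0 :> R by rewrite pnatr_eq0 -lt0n.
have H3 : is_derive t 1 (profile_slope n k) (profile_slope n k t *
    (k%:R^-1 *: ((1 + powNhalf n t)^-1 * (- (n%:R / 2) * (powNhalf n t / t))))).
  by apply: is_derive1_comp; exact: is_derive_expR.
apply: (is_derive_eq H3).
rewrite /GRing.scale /= /profile_curvature; field.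
by rewrite !lt0r_neq0 ?ltr0n.
Qed.

Lemma continuous_profile_curvature (R : realType) (n k : nat) (t : R) :
  (0 < k)%N -> 0 < t ->
  {for t, continuous (profile_curvature n k)}.
Proof.
move=> k0 t0.
have He := is_derive_powNhalf n t0; have Hs := is_derive_profile_slope n k0 t0.
have ce : powNhalf n s @[s --> t] --> powNhalf n t.
  by apply/differentiable_continuous/derivable1_diffP; exact: ex_derive.
have cs : profile_slope n k s @[s --> t] --> profile_slope n k t.
  by apply/differentiable_continuous/derivable1_diffP; exact: ex_derive.
have e1 : t * (1 + powNhalf n t) != 0.
  by rewrite lt0r_neq0 // mulr_gt0 // addr_gt0 ?expR_gt0.
apply: cvgM; last exact: cs.
apply: cvgM; first exact: cvg_cst.
apply: cvgM; first exact: ce.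
apply: cvgV => //; apply: cvgM; first exact: cvg_id.
by apply: cvgD; [exact: cvg_cst | exact: ce].
Qed.

Lemma exists_profile (R : realType) (n k : nat) (alpha beta : R) :
  (0 < n)%N -> (0 < k)%N -> 0 < alpha ->
  exists w : R -> R, C2_on alpha beta w /\ forall t, alpha < t < beta ->
    [/\ 0 < w^`()%classic t, w^`(2)%classic t != 0 &
      w^`()%classic t ^+ k +
      k%:R / n%:R * (2 * t) * w^`()%classic t ^+ k.-1 * w^`(2)%classic t = 1].
Proof.
move=> n0 k0 a0.
have [t t0|w wP] := @antiderivative_pos R alpha beta (profile_slope n k) a0.
  by have H := is_derive_profile_slope n k0 t0; exact: ex_derive.
exists w.
have w1 (t : R) : alpha < t < beta -> w^`()%classic t = profile_slope n k t.
  by move=> /wP H; rewrite derive1E derive_val.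
have near1 (t : R) : alpha < t < beta ->
    \forall s \near t, w^`()%classic s = profile_slope n k s.
  move=> tI; have tI' : t \in `]alpha, beta[ by rewrite in_itv.
  by apply: filterS (near_in_itvoo tI') => s; rewrite in_itv /=; exact: w1.
have dw2 (t : R) : alpha < t < beta ->
    is_derive t 1 w^`()%classic (profile_curvature n k t).
  move=> tI; apply: (@near_eq_is_derive _ _ _ (profile_slope n k)).
    by apply: filterS (near1 t tI).
  by apply: is_derive_profile_slope => //; case/andP: tI => [/(lt_trans a0)].
have w2 (t : R) : alpha < t < beta -> w^`(2)%classic t = profile_curvature n k t.
  by move=> /dw2 H; rewrite derive1nS derive1n1 derive1E derive_val.
split=> t tI; have t0 : 0 < t by case/andP: tI => [/(lt_trans a0)].
  split.
  - by have H := wP _ tI; exact: ex_derive.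
  - by have H := dw2 _ tI; exact: ex_derive.
  - have near2 : \forall s \near t, profile_curvature n k s = w^`(2)%classic s.
      have tI' : t \in `]alpha, beta[ by rewrite in_itv.
      by apply: filterS (near_in_itvoo tI') => s; rewrite in_itv /= => /w2.
    rewrite /prop_for /continuous_at w2 //.
    have : {for t, continuous (profile_curvature n k)}.
      exact: continuous_profile_curvature.
    by apply: cvg_trans;exact: near_eq_cvg near2.
rewrite w1 // w2 // profile_ode // profile_curvature_neq0 //.
by split=> //; exact: profile_slope_gt0.
Qed.

(** * Sufficiency: evaluation of the operator in the two cases *)

Lemma det_diag_rank1 (R : fieldType) (n : nat) (d y : 'rV[R]_n) (q : R) :
  (forall i, d 0 i != 0) ->
  \det (diag_mx d + (q *: y^T) *m y) =
  (\prod_i d 0 i) * (1 + q * \sum_i y 0 i ^+ 2 / d 0 i).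
Proof.
move=> d0; set B := diag_mx (\row_i (d 0 i)^-1).
have dB : diag_mx d *m B = 1%:M.
  apply/matrixP => i j; rewrite mul_diag_mx !mxE; have [->|_] := eqVneq i j.
    by rewrite mulr1n mulfV.
  by rewrite mulr0n mulr0.
have := det_rank1_update (q *: y^T) y dB; rewrite mul1r det_diag => ->.
congr (_ * (1 + _)); rewrite -scalemxAr mxE; congr (_ * _).
rewrite mxE; apply: eq_bigr => i _; rewrite mul_mx_diag !mxE; ring.
Qed.

(** The eigenvalue [p] is shifted once, in the direction of [y]; placing the shifted one at [ord0]
    is a convention. The rank-one formula is used over polynomials with [B = 1] and [d = 'X - p],
    and the surplus factor [d] is cancelled. *)
Lemma char_poly_scalar_rank1 (R : fieldType) (n : nat) (y : 'rV[R]_n.+1) (p q : R) :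
  char_poly (p%:M + (q *: y^T) *m y) =
  \prod_(i < n.+1) ('X - (p + (q * \sum_j y 0 j ^+ 2) *+ (i == ord0))%:P).
Proof.
set c := 'X - p%:P; set r := q * _.
have c0 : c != 0 by rewrite polyXsubC_eq0.
have ME : char_poly_mx (p%:M + (q *: y^T) *m y) =
          c%:M + map_mx polyC (- q *: y^T) *m map_mx polyC y.
  rewrite /char_poly_mx map_mxD map_scalar_mx map_mxM opprD addrA -raddfB /=.
  by congr (_ + _); rewrite scaleNr map_mxN mulNmx.
have C1 : c%:M *m (1%:M : 'M[{poly R}]_n.+1) = c%:M by exact: mulmx1.
have := det_rank1_update (map_mx polyC (- q *: y^T)) (map_mx polyC y) C1.
rewrite -ME mulmx1 det_scalar -map_mxM mxE => H.
apply: (mulfI c0); rewrite H big_ord_recl /= mulr1n exprS -mulrA; congr (_ * _).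
rewrite (eq_bigr (fun=> c)) => [|i _]; last by rewrite /= mulr0n addr0.
rewrite prodr_const card_ord mulrC; congr (_ * _).
rewrite -scalemxAr mxE mulNr polyCN polyCD /c /r opprD addrA; congr (_ - (_ * _)%:P).
by rewrite mxE; apply: eq_bigr => i _; rewrite mxE expr2.
Qed.

Lemma hessian_radial_rank1 (R : realType) (n : nat) (a : 'rV[R]_n) (alpha beta : R)
    (w : R -> R) (x : 'rV[R]_n) (s := half_quad a x)
    (y := \row_i (a 0 i * x 0 i)) :
  C2_on alpha beta w -> shell a alpha beta x ->
  hessian (fun y => w (half_quad a y)) x =
  diag_mx (w^`()%classic s *: a) + (w^`(2)%classic s *: y^T) *m y.
Proof.
move=> wC2 xs; rewrite (hessian_radial wC2 xs) -/s; congr (_ + _).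
  by apply/matrixP => i j; rewrite !mxE mulrnAr.
rewrite -scalemxAl; congr (_ *: _).
by apply/matrixP => i j; rewrite !mxE big_ord1 !mxE.
Qed.

(** The sum of [y_i ^ 2 / (p * a_i)], where [y_i = a_i * x_i], equals [2 * s / p] whatever [a] is,
    so for [k = n] the determinant depends on [x] only through [s]. *)
Lemma sigma_hessian_full (R : realType) (n : nat) (a : 'rV[R]_n) (alpha beta : R)
    (w : R -> R) (x : 'rV[R]_n) (s := half_quad a x) (p := w^`()%classic s) :
  C2_on alpha beta w -> shell a alpha beta x -> (0 < n)%N ->
  (forall i, a 0 i != 0) -> p != 0 ->
  sigma n (eigenvalues (hessian (fun y => w (half_quad a y)) x)) =
  (\prod_i a 0 i) * (p ^+ n + 2 * s * p ^+ n.-1 * w^`(2)%classic s).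
Proof.
move=> wC2 xs n0 a0 p0; rewrite (hessian_radial_rank1 wC2 xs) -/s -/p.
rewrite sigma_eigenvalues_symmetric_det; last first.
  rewrite linearD /= tr_diag_mx -scalemxAl.
  by rewrite [(_ *: (_ *m _))^T]linearZ /= trmx_mul trmxK.
rewrite det_diag_rank1 => [|i]; last by rewrite mxE mulf_neq0.
rewrite (eq_bigr (fun i => p * a 0 i)) => [|i _]; last by rewrite mxE.
rewrite big_split /= prodr_const card_ord.
rewrite [\sum_i _](eq_bigr (fun i => p^-1 * (a 0 i * x 0 i ^+ 2))) => [|i _]; last first.
  by rewrite !mxE; field; rewrite a0 p0.
rewrite -mulr_sumr (_ : \sum_i _ = 2 * s); last by rewrite /s /half_quad mulVKf.
have -> : p ^+ n = p * p ^+ n.-1 by rewrite -exprS prednK.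
by field.
Qed.

(** The eigenvalues are [p * c], with multiplicity [n - 1], and one shifted by [q * (2 * s) * c],
    where [q] is the second derivative of [w] at [s]; the factor [k/n] is the ratio of
    ['C(n.-1, k.-1)] to ['C(n, k)]. *)
Lemma sigma_hessian_round (R : realType) (n k : nat) (a : 'rV[R]_n) (c : R)
    (alpha beta : R)
    (w : R -> R) (x : 'rV[R]_n) (s := half_quad a x) (p := w^`()%classic s) :
  C2_on alpha beta w -> shell a alpha beta x -> (0 < k <= n)%N ->
  (forall i, a 0 i = c) ->
  sigma k (eigenvalues (hessian (fun y => w (half_quad a y)) x)) =
  c ^+ k *+ 'C(n, k) *
  (p ^+ k + k%:R / n%:R * (2 * s) * p ^+ k.-1 * w^`(2)%classic s).
Proof.
move=> wC2 xs /andP[k0 kn] ac; rewrite (hessian_radial_rank1 wC2 xs) -/s -/p.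
case: k k0 kn => // k _; case: n a x @s @p ac xs => [|n] // a x s p ac xs kn.
set q := w^`(2)%classic s.
have -> : diag_mx (p *: a) = (p * c)%:M.
  by apply/matrixP => i j; rewrite !mxE ac.
set y := \row_i _.
have yE : q * \sum_j y 0 j ^+ 2 = q * (2 * s) * c.
  rewrite -mulrA; congr (_ * _); rewrite /s /half_quad mulVKf // mulr_suml.
  by apply: eq_bigr => i _; rewrite mxE ac; ring.
pose lam := \row_(i < n.+1) (p * c + (q * (2 * s) * c) *+ (i == ord0)).
rewrite (@sigma_eigenvalues _ _ _ _ lam) //; last first.
  by rewrite char_poly_scalar_rank1 yE; apply: eq_bigr => i _; rewrite mxE.
rewrite sigmaE (@coef_esympolyD1 _ _ predT _ ord0) //.
have -> : esympoly (fun i : 'I_n.+1 => predT i && (i != ord0)) (lam 0) =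
          esympoly (fun i : 'I_n.+1 => predT i && (i != ord0)) (fun=> p * c).
  by apply: eq_bigr => i /= /negbTE i0; rewrite mxE i0 addr0.
have cn : #|(fun i : 'I_n.+1 => predT i && (i != ord0))| = n.
  by rewrite (cardC1 (ord0 : 'I_n.+1)) card_ord.
rewrite !esympoly_const cn mxE eqxx mulr1n binS.
have binE : 'C(n, k)%:R = k.+1%:R / n.+1%:R * ('C(n, k.+1) + 'C(n, k))%:R :> R.
  have n0 : n.+1%:R != 0 :> R by rewrite pnatr_eq0.
  rewrite -binS; apply: (mulfI n0); rewrite -natrM mul_bin_diag natrM.
  by rewrite mulrA [k.+1%:R / _]mulrC mulVKf.
rewrite -[_ *+ (_ + _)]mulr_natr -[_ *+ 'C(n, k.+1)]mulr_natr.
rewrite -[_ *+ 'C(n, k)]mulr_natr natrD !exprMn !exprS.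
move: binE; rewrite natrD -/q.
move: ('C(n, k)%:R) ('C(n, k.+1)%:R) (k.+1%:R / n.+1%:R) => v u kappa vE.
clearbody p q s.
transitivity (c * c ^+ k * ((u + v) * (p * p ^+ k) + 2 * s * p ^+ k * q * v)).
  by ring.
(* Only the [v] multiplying [q] is replaced by [kappa * (u + v)]; the other one already belongs to
   the binomial sum [u + v]. *)
by rewrite {2}vE; ring.
Qed.

Unset Implicit Arguments.

Theorem proposition1p4 (R : realType) (n k : nat) (a : 'rV[R]_n)
    (alpha beta : R)
    (hn : (3 <= n)%N) (hk1 : (1 <= k)%N) (hkn : (k <= n)%N)
    (hA : calA k (diag_mx a))
    (halpha : 0 < alpha) (hab : alpha < beta) :
  (exists w : R -> R,
     [/\ C2_on alpha beta w,
         (exists t : R, alpha < t < beta /\ w^`(2)%classic t != 0) &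
         solves_hessian_eq k (shell a alpha beta)
           (fun x : 'rV[R]_n => w (half_quad a x))])
  <->
  (k = n \/ forall i : 'I_n, a 0 i = cstar R n k).
Proof.
have [apos asig] := calA_diag hkn hA.
have n0 : (0 < n)%N by exact: leq_trans hn.
split=> [[w [wC2 [t [tI w2]] sol]]|kn].
  have [->|kn] := eqVneq k n; [by left | right].
  apply: (necessity _ apos asig _ wC2 tI w2 sol); first by rewrite hk1 ltn_neqAle kn.
  by case/andP: tI => [/(lt_trans halpha)].
have [w [wC2 wP]] := exists_profile beta n0 hk1 halpha.
exists w; split=> // [|x xs].
  exists ((alpha + beta) / 2).
  have tI : alpha < (alpha + beta) / 2 < beta by rewrite !midf_lt.
  by have [_ ? _] := wP _ tI.
have [p0 _ ode] := wP _ xs.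
case: kn => [kn|ac].
  subst k; rewrite (sigma_hessian_full wC2 xs) ?lt0r_neq0 // => [|i];
    last exact: lt0r_neq0.
  (* The product of the [a 0 i] is [sigma n a], equal to 1 by [asig]; the ratio [n/n] in [ode] is 1
     as well. *)
  rewrite -det_diag -sigma_eigenvalues_symmetric_det ?tr_diag_mx //.
  rewrite sigma_eigenvalues_diag // asig mul1r -[RHS]ode divff ?mul1r //.
  by rewrite pnatr_eq0 -lt0n.
rewrite (sigma_hessian_round wC2 xs _ ac) ?hk1 // ode mulr1.
(* The remaining factor is [sigma k] of the constant vector [a], hence 1. *)
rewrite -asig sigmaE (_ : a 0 = fun=> cstar R n k) ?esympoly_const ?card_ord //.
exact/funext.
Qed.
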